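(* Let $\lambda$ be a nonzero real number, let $r\ge 1$ be an integer, and let $x\in\mathbb{R}$. For every integer $n\ge 0$, $$\beta_{n,\lambda}^{(r)}(x)=\sum_{k=0}^{n}D_{k,\lambda}^{(r)}(x)\,S_{2,\lambda}(n,k).$$
   Context: Generating functions are power series in $t$ (formal, or convergent for $|t|$ small), with $(1+t)^{x}=\sum_{n\ge 0}(x)_n\frac{t^n}{n!}$, where $(x)_0=1$ and $(x)_n=x(x-1)\cdots(x-n+1)$ for $n\ge1$. Also $(x)_{0,\lambda}=1$ and $(x)_{n,\lambda}=x(x-\lambda)\cdots(x-(n-1)\lambda)$ for $n\ge 1$, and $(1+\lambda t)^{x/\lambda}=\sum_{n\ge0}(x)_{n,\lambda}\frac{t^n}{n!}$. The degenerate logarithm is $\log_\lambda(1+t)=\frac{1}{\lambda}\left((1+t)^\lambda-1\right)$. The degenerate Daehee polynomials of order $r$ are defined by $$\sum_{n=0}^{\infty}D_{n,\lambda}^{(r)}(x)\frac{t^{n}}{n!}=\left(\frac{\log(1+t)}{t}\right)^{r}\int_{0}^{1}\cdots\int_{0}^{1}(1+t)^{\lambda(x_{1}+\cdots+x_{r})+x}dx_{1}\cdots dx_{r}=\left(\frac{\log_{\lambda}(1+t)}{t}\right)^{r}(1+t)^{x}.$$ The degenerate Bernoulli polynomials of order $r$ are defined by $\left(\frac{t}{(1+\lambda t)^{1/\lambda}-1}\right)^{r}(1+\lambda t)^{x/\lambda}=\sum_{n=0}^\infty\beta_{n,\lambda}^{(r)}(x)\frac{t^n}{n!}$. The degenerate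 Stirling numbers of the second kind $S_{2,\lambda}(n,l)$ are defined by the polynomial identity in $x$: $(x)_{n,\lambda}=\sum_{l=0}^n S_{2,\lambda}(n,l)(x)_l$ for $n\ge0$. *)

(* Defs.v *)
From HB Require Import structures.
From mathcomp Require Import all_boot all_order all_algebra.
From mathcomp Require Import boolp reals.

Set Implicit Arguments.
Unset Strict Implicit.
Unset Printing Implicit Defensive.

Import Order.TTheory GRing.Theory Num.Theory.
Local Open Scope ring_scope.

(** * Formal power series in one variable [t] over a field *)

(* [f n] is the coefficient of [t ^ n] in [f]. *)
Record fps (K : Type) := Fps { fps_coef :> nat -> K }.

HB.instance Definition _ (K : Type) := gen_eqMixin (fps K).
HB.instance Definition _ (K : Type) := gen_choiceMixin (fps K).

Lemma fpsP (K : Type) (f g : fps K) : f =1 g -> f = g.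
Proof. by case: f g => [f] [g] /= /funext ->. Qed.

Section FpsRing.
Variable K : fieldType.
Implicit Types (f g h : fps K) (c : K).

Definition fps_zero : fps K := Fps (fun=> 0).
Definition fps_opp f : fps K := Fps (fun n => - f n).
Definition fps_add f g : fps K := Fps (fun n => f n + g n).

Fact fps_addA : associative fps_add.
Proof. by move=> f g h; apply: fpsP => n /=; rewrite addrA. Qed.
Fact fps_addC : commutative fps_add.
Proof. by move=> f g; apply: fpsP => n /=; rewrite addrC. Qed.
Fact fps_add0 : left_id fps_zero fps_add.
Proof. by move=> f; apply: fpsP => n /=; rewrite add0r. Qed.
Fact fps_addN : left_inverse fps_zero fps_opp fps_add.
Proof. by move=> f; apply: fpsP => n /=; rewrite addNr. Qed.

HB.instance Definition _ :=
  GRing.isZmodule.Build (fps K) fps_addA fps_addC fps_add0 fps_addN.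

Definition fps_one : fps K := Fps (fun n => (n == 0%N)%:R).
Definition fps_mul f g : fps K :=
  Fps (fun n => \sum_(i < n.+1) f i * g (n - i)%N).

Let trunc m f : {poly K} := \poly_(i < m) f i.

Fact fps_mul_trunc m f g n :
  (n < m)%N -> fps_mul f g n = (trunc m f * trunc m g)`_n.
Proof.
move=> nm; rewrite coefM; apply: eq_bigr => i _; rewrite !coef_poly.
rewrite (leq_ltn_trans _ nm) ?(leq_ltn_trans (leq_subr _ _) nm) //.
by rewrite -ltnS.
Qed.

Fact fps_mulC : commutative fps_mul.
Proof.
by move=> f g; apply: fpsP => n; rewrite !(@fps_mul_trunc n.+1) // mulrC.
Qed.

Fact fps_mulA : associative fps_mul.
Proof.
move=> f g h; apply: fpsP => n.
transitivity ((trunc n.+1 f * (trunc n.+1 g * trunc n.+1 h))`_n).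
  rewrite coefM; apply: eq_bigr => i _; rewrite coef_poly ltn_ord.
  by rewrite (@fps_mul_trunc n.+1) // ltnS leq_subr.
rewrite mulrA coefM; apply: eq_bigr => i _.
rewrite (@fps_mul_trunc n.+1) // [in X in _ * X]coef_poly.
by rewrite ltnS leq_subr.
Qed.

Fact fps_mul1 : left_id fps_one fps_mul.
Proof.
move=> f; apply: fpsP => n /=.
rewrite big_ord_recl /= mul1r subn0 big1 ?addr0 // => i _.
by rewrite mul0r.
Qed.

Fact fps_mulDl : left_distributive fps_mul fps_add.
Proof.
move=> f g h; apply: fpsP => n /=; rewrite -big_split /=.
by apply: eq_bigr => i _; rewrite mulrDl.
Qed.

Fact fps_one_neq0 : fps_one != 0 :> fps K.
Proof.
by apply/eqP => /(congr1 (fun f : fps K => f 0%N)) /eqP /=; rewrite oner_eq0.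
Qed.

HB.instance Definition _ := GRing.Zmodule_isComNzRing.Build (fps K)
  fps_mulA fps_mulC fps_mul1 fps_mulDl fps_one_neq0.

Definition fps_scale c f : fps K := Fps (fun n => c * f n).

Fact fps_scaleA a b f : fps_scale a (fps_scale b f) = fps_scale (a * b) f.
Proof. by apply: fpsP => n /=; rewrite mulrA. Qed.
Fact fps_scale1 : left_id 1 fps_scale.
Proof. by move=> f; apply: fpsP => n /=; rewrite mul1r. Qed.
Fact fps_scaleDr : right_distributive fps_scale +%R.
Proof. by move=> c f g; apply: fpsP => n /=; rewrite mulrDr. Qed.
Fact fps_scaleDl f : {morph fps_scale^~ f : a b / a + b}.
Proof. by move=> a b; apply: fpsP => n /=; rewrite mulrDl. Qed.

HB.instance Definition _ := GRing.Zmodule_isLmodule.Build K (fps K)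
  fps_scaleA fps_scale1 fps_scaleDr fps_scaleDl.

(* Coefficients n, n-1, ..., 0 of the inverse of [f], from the recursion
   f_0 * b_n.+1 = - \sum_(i <= n) f_i.+1 * b_(n - i). *)
Fixpoint fps_inv_seq f n : seq K :=
  if n isn't m.+1 then [:: (f 0%N)^-1]
  else let s := fps_inv_seq f m in
    - (f 0%N)^-1 * (\sum_(i < n) f i.+1 * s`_i) :: s.

Definition fps_unit : {pred fps K} := fun f => f 0%N != 0.
(* Outside the units, the convention of [unitRingType] is that inversion is
   the identity. *)
Definition fps_inv f : fps K :=
  if f \in fps_unit then Fps (fun n => (fps_inv_seq f n)`_0) else f.

Fact fps_inv_seqE f n i :
  (i <= n)%N -> (fps_inv_seq f n)`_i = (fps_inv_seq f (n - i))`_0.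
Proof.
elim: n i => [|n IHn] [|i] //=; rewrite ltnS => le_in.
by rewrite subSS IHn.
Qed.

Fact fps_mulV : {in fps_unit, left_inverse 1 fps_inv *%R}.
Proof.
move=> f f0; rewrite mulrC; apply: fpsP => n.
rewrite /fps_inv f0 /=; move: f0; rewrite unfold_in /fps_unit => f0.
case: n => [|n] /=; first by rewrite big_ord1 /= divff.
rewrite big_ord_recl /= mulNr mulrN mulrA divff // mul1r.
apply/eqP; rewrite addrC subr_eq0; apply/eqP; apply: eq_bigr => i _.
have le_in : (i <= n)%N by rewrite -ltnS.
by rewrite /bump /= add1n subSS (fps_inv_seqE f le_in).
Qed.

Fact fps_unitPl f g : g * f = 1 -> fps_unit f.
Proof.
move=> /(congr1 (fun h : fps K => h 0%N)) /=; rewrite big_ord1 /= => gf1.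
apply/negP => /eqP f0; move/eqP: gf1.
by rewrite f0 mulr0 eq_sym oner_eq0.
Qed.

Fact fps_inv_out : {in [predC fps_unit], fps_inv =1 id}.
Proof. by move=> f; rewrite inE /fps_inv => /negPf ->. Qed.

HB.instance Definition _ := GRing.ComNzRing_hasMulInverse.Build (fps K)
  fps_mulV fps_unitPl fps_inv_out.

Lemma fps_unitE f : (f \is a GRing.unit) = (f 0%N != 0).
Proof. by []. Qed.

Definition fpsX : fps K := Fps (fun n => (n == 1%N)%:R).

(* [f / t] for a series [f] without constant term. *)
Definition fps_divX f : fps K := Fps (fun n => f n.+1).

Lemma fps_divXK f : f 0%N = 0 -> fpsX * fps_divX f = f.
Proof.
move=> f0; apply: fpsP => -[|n] /=; first by rewrite big_ord1 mul0r f0.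
rewrite big_ord_recl /= mul0r add0r big_ord_recl /= mul1r subSS subn0.
by rewrite big1 ?addr0 // => i _; rewrite mul0r.
Qed.

(* The sequence whose exponential generating function is [f]. *)
Definition egf_coef f (n : nat) : K := n`!%:R * f n.

End FpsRing.

(** * Falling factorials and binomial series *)

(* (x)_n *)
Definition fall (A : pzRingType) (x : A) (n : nat) : A :=
  \prod_(i < n) (x - i%:R).

(* (x)_{n,lambda} *)
Definition dfall (A : pzRingType) (lambda x : A) (n : nat) : A :=
  \prod_(i < n) (x - lambda *+ i).

Section Degenerate.
Variable K : fieldType.
Implicit Types (lambda x : K) (r n : nat).

(* (1 + t) ^ x *)
Definition binom_series x : fps K := Fps (fun n => fall x n / n`!%:R).

(* (1 + lambda t) ^ (x / lambda) *)
Definition dexp_series lambda x : fps K :=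
  Fps (fun n => dfall lambda x n / n`!%:R).

(* log_lambda (1 + t) *)
Definition dlog_series lambda : fps K :=
  lambda^-1 *: (binom_series lambda - 1).

Lemma dlog_series0 lambda : dlog_series lambda 0%N = 0.
Proof. by rewrite /= /fall big_ord0 fact0 divr1 subrr mulr0. Qed.

Lemma dexp_series_sub1_0 lambda : (dexp_series lambda 1 - 1) 0%N = 0.
Proof. by rewrite /= /dfall big_ord0 fact0 divr1 subrr. Qed.

Lemma dexp_series_sub1_unit lambda :
  fps_divX (dexp_series lambda 1 - 1) \is a GRing.unit.
Proof.
by rewrite fps_unitE /= /dfall big_ord1 mulr0n !subr0 divr1 oner_neq0.
Qed.

(* D_{n,lambda}^{(r)}(x), from (log_lambda (1 + t) / t) ^ r * (1 + t) ^ x. *)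
Definition dDaehee lambda r x n : K :=
  egf_coef (fps_divX (dlog_series lambda) ^+ r * binom_series x) n.

(* beta_{n,lambda}^{(r)}(x); the series t / ((1 + lambda t) ^ (1 / lambda) - 1)
   is the inverse of ((1 + lambda t) ^ (1 / lambda) - 1) / t, which is a unit
   by [dexp_series_sub1_unit]. *)
Definition dBernoulli lambda r x n : K :=
  egf_coef ((fps_divX (dexp_series lambda 1 - 1))^-1 ^+ r *
            dexp_series lambda x) n.

(** * Degenerate Stirling numbers of the second kind *)

Definition is_dStirling2 lambda (S : nat -> nat -> K) : Prop :=
  forall n, dfall (lambda%:P) 'X n = \sum_(l < n.+1) S n l *: fall 'X l.

Lemma dStirling2_exists lambda : exists S, is_dStirling2 lambda S.
Proof.
pose fix S (n k : nat) {struct n} : K := if n isn't m.+1 then (k == 0%N)%:R else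
  (if k is j.+1 then S m j else 0) + (k%:R - lambda *+ m) * S m k.
have S0 n k : (n < k)%N -> S n k = 0.
  elim: n k => [|n IHn] [|k] //= ltnk.
  by rewrite !IHn ?mulr0 ?addr0 // ltnW.
exists S; elim=> [|n IHn].
  by rewrite /dfall /fall big_ord1 !big_ord0 scale1r.
rewrite {1}/dfall big_ord_recr /= -/(dfall _ _ n) IHn mulr_suml.
under [RHS]eq_bigr do rewrite scalerDl.
rewrite big_split /= [X in _ = X + _]big_ord_recl scale0r add0r.
rewrite [X in _ = _ + X]big_ord_recr /= S0 // mulr0 scale0r addr0.
rewrite -big_split /=; apply: eq_bigr => l _.
rewrite /bump /= add1n /fall big_ord_recr /= -/(fall _ l).
rewrite add0n -scalerAl [_ * S n l]mulrC -scalerA -scalerDr.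
congr (_ *: _); rewrite -mul_polyC mulrC [_%:P * _]mulrC -[LHS]mulrC -mulrDr.
congr (_ * _).
by rewrite polyCB !polyCMn polyC1 addrA subrK.
Qed.

(* The values [dStirling2 lambda n l] with [n < l] are unspecified. *)
Definition dStirling2 lambda : nat -> nat -> K :=
  projT1 (cid (dStirling2_exists lambda)).

Lemma dStirling2P lambda : is_dStirling2 lambda (dStirling2 lambda).
Proof. exact: projT2 (cid (dStirling2_exists lambda)). Qed.

End Degenerate.

(* Main.v *)
Require Import Defs.
From HB Require Import structures.
From mathcomp Require Import all_boot all_order all_algebra.
From mathcomp Require Import ring.
From mathcomp Require Import reals.
Import GRing.Theory Num.Theory.
Local Open Scope ring_scope.

(** Write [U] for the series [(1 + lambda t)^(1/lambda) - 1].  The theorem is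
    the effect of the substitution [t := U] on the generating function of the
    degenerate Daehee polynomials: [1 + t] becomes [(1 + lambda t)^(1/lambda)],
    so [(1 + t)^x] becomes [(1 + lambda t)^(x/lambda)], [log_lambda (1 + t)]
    becomes [t], and hence [(log_lambda (1 + t) / t)^r * (1 + t)^x] becomes
    [(t / U)^r * (1 + lambda t)^(x/lambda)], the generating function of the
    degenerate Bernoulli polynomials.

    On exponential generating functions this substitution is the matrix of
    degenerate Stirling numbers, and it is more convenient to start from that
    matrix.  Let [L] be the linear map ([stirling]) on series with
    [n! (L f)_n = \sum_(k <= n) k! f_k S(n, k)].  The defining identity of
    [S], evaluated at [y], says that [L] sends [(1 + t)^y] to
    [(1 + lambda t)^(y/lambda)] for every scalar [y]
    ([stirling_binom_series]).  As both families turn addition of exponents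
    into multiplication of series ([dexp_seriesD], [binom_seriesD]), linearity
    alone gives
    - [L (t^k) = U^k], since [t = (1 + t) - 1] ([stirling_fpsX_exp]), and then
      [L (t * f) = U * L f] for all [f], because each coefficient of [L f]
      depends on finitely many coefficients of [f] ([stirling_mulX]);
    - [L (log_lambda (1 + t)^r * (1 + t)^x)
       = t^r * (1 + lambda t)^(x/lambda)] ([stirling_dlog_series]).
    With [log_lambda (1 + t) = t * W] and [U = t * V], the two facts yield
    [(t * V)^r * L (W^r * (1 + t)^x) = t^r * (1 + lambda t)^(x/lambda)], and
    it remains to cancel [t^r] and divide by the unit [V^r]. *)

(** * Truncation and multiplication by [t] *)

Section FpsComplements.
Variable K : fieldType.
Implicit Types (f g h : fps K) (c : K).

Lemma fps_scalerAl c f g : c *: f * g = c *: (f * g).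
Proof.
apply: fpsP => n /=; rewrite mulr_sumr.
by apply: eq_bigr => i _; rewrite mulrA.
Qed.

Lemma fps_scalerAr c f g : f * (c *: g) = c *: (f * g).
Proof. by rewrite mulrC fps_scalerAl mulrC. Qed.

Lemma fps_coef_sum (I : Type) (s : seq I) (F : I -> fps K) n :
  (\sum_(i <- s) F i : fps K) n = \sum_(i <- s) F i n.
Proof. by elim/big_rec2: _ => //= i a b _ ->. Qed.

Lemma fps_coefXM f n : (fpsX K * f) n = if n is m.+1 then f m else 0.
Proof.
case: n => [|n] /=; first by rewrite big_ord1 mul0r.
rewrite big_ord_recl /= mul0r add0r big_ord_recl /= mul1r subSS subn0.
by rewrite big1 ?addr0 // => i _; rewrite mul0r.
Qed.

Lemma fps_coefXn k n : (fpsX K ^+ k) n = (n == k)%:R.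
Proof.
by elim: k n => [|k IHk] [|n] //; rewrite exprS fps_coefXM ?IHk.
Qed.

Lemma fps_mulXnI k : injective (fun f => fpsX K ^+ k * f).
Proof.
have mulXI : injective (fun f => fpsX K * f).
  move=> f g eq_fg; apply: fpsP => n.
  by move: (congr1 (fun h : fps K => h n.+1) eq_fg); rewrite !fps_coefXM.
elim: k => [|k IHk] f g; first by rewrite !expr0 !mul1r.
by rewrite !exprS -!mulrA => /mulXI /IHk.
Qed.

Lemma fps_coefM_local f g h n :
  (forall k, (k <= n)%N -> g k = h k) -> (f * g) n = (f * h) n.
Proof. by move=> eq_gh; apply: eq_bigr => i _; rewrite eq_gh ?leq_subr. Qed.

Definition fps_trunc f n : fps K := \sum_(k < n.+1) f k *: fpsX K ^+ k.

Lemma fps_coef_trunc f n k : (k <= n)%N -> fps_trunc f n k = f k.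
Proof.
move=> le_kn; rewrite /fps_trunc fps_coef_sum.
rewrite (bigD1 (inord k)) //= fps_coefXn inordK ?ltnS // eqxx mulr1.
rewrite big1 ?addr0 // => i ne_ik; rewrite fps_coefXn.
case: eqP => [eq_ki | _]; last by rewrite mulr0.
by case/eqP: ne_ik; apply: val_inj; rewrite /= inordK ?ltnS.
Qed.

End FpsComplements.

Arguments fps_trunc {K}.

(** * The exponent laws *)

Section ExponentLaws.
Variable K : numFieldType.
Implicit Types (lambda x y : K) (n : nat).

Let natrS_neq0 n : (n.+1%:R : K) != 0.
Proof. by rewrite pnatr_eq0. Qed.

(** Coefficientwise form of the differential equation
    [(1 + lambda t) f' = x f], which determines the series up to its constant
    term. *)
Lemma dexp_series_rec lambda x n :
  n.+1%:R * dexp_series lambda x n.+1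
  = (x - lambda *+ n) * dexp_series lambda x n.
Proof.
have fn0 : (n`!%:R : K) != 0 by rewrite pnatr_eq0 -lt0n fact_gt0.
rewrite /= /dfall big_ord_recr /= factS natrM.
by move: (natrS_neq0 n) => Sn0; field; rewrite fn0 nat1r Sn0.
Qed.

(** The product satisfies the differential equation of the left-hand side, by
    the Leibniz rule. *)
Lemma dexp_seriesD lambda x y :
  dexp_series lambda (x + y) = dexp_series lambda x * dexp_series lambda y.
Proof.
apply: fpsP; elim=> [|n IHn].
  by rewrite /= big_ord1 /dfall !big_ord0 /= fact0 !divr1 mulr1.
apply: (mulfI (natrS_neq0 n)); rewrite dexp_series_rec IHn.
have := dexp_series_rec lambda y; have := dexp_series_rec lambda x.
move: (dexp_series _ x) (dexp_series _ y) => a b a_rec b_rec /=.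
(* The factor [n.+1] is split as [i + (n.+1 - i)] in the [i]-th term. *)
transitivity (\sum_(i < n.+2) i%:R * a i * b (n.+1 - i)%N
            + \sum_(i < n.+2) a i * ((n.+1 - i)%:R * b (n.+1 - i)%N)); last first.
  rewrite -big_split /= mulr_sumr; apply: eq_bigr => i _.
  have ->: n.+1%:R = (n.+1 - i)%:R + i%:R :> K.
    by rewrite -natrD subnK // -ltnS.
  ring.
rewrite [X in _ = X + _]big_ord_recl [X in _ = _ + X]big_ord_recr /=.
rewrite subnn !mul0r mulr0 add0r addr0 -big_split /= mulr_sumr.
apply: eq_bigr => i _; have le_i : (i <= n)%N by rewrite -ltnS.
rewrite /bump /= add1n subSS a_rec subSn // b_rec.
have ->: lambda *+ n = lambda *+ (n - i) + lambda *+ i.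
  by rewrite -mulrnDr subnK.
ring.
Qed.

Lemma binom_seriesE y : binom_series y = dexp_series 1 y.
Proof. by []. Qed.

Lemma binom_seriesD x y :
  binom_series (x + y) = binom_series x * binom_series y.
Proof. by rewrite !binom_seriesE dexp_seriesD. Qed.

Lemma dexp_series0 lambda : dexp_series lambda 0 = 1.
Proof.
apply: fpsP => -[|n] /=; first by rewrite /dfall big_ord0 divr1.
by rewrite /dfall big_ord_recl /= mulr0n subrr !mul0r.
Qed.

(** The exponent [lambda] of [(1 + lambda t)^(x / lambda)] is the power 1, so
    the series stops after its linear term. *)
Lemma dexp_series_lambda lambda :
  dexp_series lambda lambda = 1 + lambda *: fpsX K.
Proof.
apply: fpsP => -[|[|n]] /=.
- by rewrite /dfall big_ord0 divr1 mulr0 addr0.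
- by rewrite /dfall big_ord1 mulr0n subr0 divr1 mulr1 add0r.
by rewrite /dfall 2!big_ord_recl /= subrr !(mul0r, mulr0) addr0.
Qed.

Lemma binom_series1 : binom_series 1 = 1 + fpsX K.
Proof. by rewrite binom_seriesE dexp_series_lambda scale1r. Qed.

End ExponentLaws.

(** * The Stirling transform *)

Section StirlingTransform.
Variables (K : numFieldType) (lambda : K).
Implicit Types (f g : fps K) (x y : K) (n k r : nat).

Definition stirling f : fps K :=
  Fps (fun n =>
    (\sum_(k < n.+1) egf_coef f k * dStirling2 lambda n k) / n`!%:R).

Local Notation U := (dexp_series lambda 1 - 1).

Lemma egf_coef_stirling f n :
  egf_coef (stirling f) n
  = \sum_(k < n.+1) egf_coef f k * dStirling2 lambda n k.
Proof.
by rewrite {1}/egf_coef /= mulrC divfK // pnatr_eq0 -lt0n fact_gt0.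
Qed.

Lemma stirling_is_linear : linear stirling.
Proof.
move=> c f g; apply: fpsP => n /=.
rewrite mulrA -mulrDl mulr_sumr -big_split /=; congr (_ / _).
by apply: eq_bigr => k _; rewrite /egf_coef /=; ring.
Qed.

HB.instance Definition _ :=
  GRing.isLinear.Build K (fps K) (fps K) *:%R stirling stirling_is_linear.

Lemma stirling_local f g n :
  (forall k, (k <= n)%N -> f k = g k) -> stirling f n = stirling g n.
Proof.
move=> eq_fg /=; congr (_ / _); apply: eq_bigr => k _.
by rewrite /egf_coef eq_fg // -ltnS.
Qed.

(** This is the identity defining the Stirling numbers, with its
    indeterminate evaluated at [y]. *)
Lemma stirling_binom_series y :
  stirling (binom_series y) = dexp_series lambda y.
Proof.
have hornerF n : (fall 'X n).[y] = fall y n.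
  rewrite /fall horner_prod; apply: eq_bigr => i _.
  by rewrite hornerD hornerN hornerX -polyC_natr hornerC.
have hornerD n : (dfall lambda%:P 'X n).[y] = dfall lambda y n.
  rewrite /dfall horner_prod; apply: eq_bigr => i _.
  by rewrite hornerD hornerN hornerX -polyCMn hornerC.
apply: fpsP => n /=; congr (_ / _).
rewrite -hornerD dStirling2P horner_sum; apply: eq_bigr => k _.
rewrite hornerZ hornerF /egf_coef /= mulrC; congr (_ * _).
by rewrite mulrC divfK // pnatr_eq0 -lt0n fact_gt0.
Qed.

(** The extra factor [(1 + t)^y] makes the induction work: each factor
    [t = (1 + t) - 1] splits the series into two with shifted [y]. *)
Lemma stirling_binom_seriesXn y k :
  stirling (binom_series y * fpsX K ^+ k) = dexp_series lambda y * U ^+ k.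
Proof.
elim: k y => [|k IHk] y; first by rewrite !expr0 !mulr1 stirling_binom_series.
have ->: binom_series y * fpsX K ^+ k.+1 =
         binom_series (y + 1) * fpsX K ^+ k - binom_series y * fpsX K ^+ k.
  by rewrite binom_seriesD binom_series1 exprS; ring.
by rewrite linearB /= !IHk dexp_seriesD exprS; ring.
Qed.

Lemma stirling_fpsX_exp k : stirling (fpsX K ^+ k) = U ^+ k.
Proof.
have := stirling_binom_seriesXn 0 k.
by rewrite binom_seriesE !dexp_series0 !mul1r.
Qed.

(** The [n]-th coefficients of both sides only see the truncation of [f] at
    degree [n], where the identity is a linear combination of
    [stirling_fpsX_exp]. *)
Lemma stirling_mulX f : stirling (fpsX K * f) = U * stirling f.
Proof.
apply: fpsP => n; set p := fps_trunc f n.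
have eq_fp k : (k <= n)%N -> f k = p k by move=> ?; rewrite fps_coef_trunc.
rewrite (@stirling_local _ (fpsX K * p)) => [|k le_kn]; last first.
  by apply: fps_coefM_local => i le_ik; rewrite eq_fp // (leq_trans le_ik).
rewrite [RHS](@fps_coefM_local _ _ _ (stirling p)) => [|k le_kn]; last first.
  by apply: stirling_local => i le_ik; rewrite eq_fp // (leq_trans le_ik).
congr (fps_coef _ n); rewrite /p /fps_trunc mulr_sumr !linear_sum mulr_sumr.
apply: eq_bigr => k _; rewrite fps_scalerAr !linearZ /= fps_scalerAr -exprS.
by rewrite !stirling_fpsX_exp exprS.
Qed.

Lemma stirling_mulXn r f : stirling (fpsX K ^+ r * f) = U ^+ r * stirling f.
Proof.
by elim: r => [|r IHr]; rewrite ?expr0 ?mul1r // !exprS -!mulrA stirling_mulX IHr.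
Qed.

(** The substitution turns [log_lambda (1 + t)] into [t].  As in
    [stirling_binom_seriesXn], the powers are reached by shifting the
    exponent, here by [lambda]. *)
Lemma stirling_dlog_series r x : lambda != 0 ->
  stirling (dlog_series lambda ^+ r * binom_series x)
  = fpsX K ^+ r * dexp_series lambda x.
Proof.
move=> lambda_neq0; elim: r x => [|r IHr] x.
  by rewrite !expr0 !mul1r stirling_binom_series.
set D := dlog_series lambda.
have ->: D ^+ r.+1 * binom_series x = lambda^-1 *:
    (D ^+ r * binom_series (x + lambda) - D ^+ r * binom_series x).
  rewrite exprS binom_seriesD /D {1}/dlog_series -mulrA fps_scalerAl.
  by congr (_ *: _); ring.
rewrite linearZ linearB /= !IHr dexp_seriesD dexp_series_lambda.
rewrite -[RHS]scale1r -(mulVf lambda_neq0) -scalerA; congr (_ *: _).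
rewrite mulrDr mulr1 mulrDr addrAC subrr add0r !fps_scalerAr exprS.
by congr (_ *: _); ring.
Qed.

End StirlingTransform.

Arguments stirling {K}.

(** * Daehee and Bernoulli generating functions *)

Lemma stirling_dDaehee_series (K : numFieldType) (lambda x : K) (r : nat) :
  lambda != 0 ->
  stirling lambda (fps_divX (dlog_series lambda) ^+ r * binom_series x)
  = (fps_divX (dexp_series lambda 1 - 1))^-1 ^+ r * dexp_series lambda x.
Proof.
move=> lambda_neq0.
set V := fps_divX (_ - 1); set W := fps_divX _; set B := binom_series x.
have unitV : V ^+ r \is a GRing.unit.
  exact: unitrX (dexp_series_sub1_unit lambda).
have eqU : dexp_series lambda 1 - 1 = fpsX K * V.
  by rewrite fps_divXK // dexp_series_sub1_0.
have eqD : dlog_series lambda = fpsX K * W.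
  by rewrite fps_divXK // dlog_series0.
rewrite exprVn; apply: (mulrI unitV); rewrite mulVKr //.
apply: (fps_mulXnI _ r).
rewrite mulrA -exprMn -eqU -stirling_mulXn mulrA -exprMn -eqD.
exact: stirling_dlog_series.
Qed.

Theorem theorem3p2 (R : realType) (lambda : R) (r : nat) (x : R)
    (lambda_neq0 : lambda != 0) (r_ge1 : (1 <= r)%N) (n : nat) :
  dBernoulli lambda r x n =
  \sum_(0 <= k < n.+1) dDaehee lambda r x k * dStirling2 lambda n k.
Proof.
rewrite /dBernoulli -stirling_dDaehee_series // egf_coef_stirling.
by rewrite big_mkord.
Qed.
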